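(* Let $0<q<1$. (a) The function $\psi_q(x)$ has a unique zero $x_0$ in the interval $(1,2)$. (b) With this $x_0$, there holds $\Gamma_q(x)\geq \Gamma_q(x_0)$ for all $x\in(0,\infty)$.
   Context: For $0<q<1$ and complex $a$, $(a;q)_\infty=\prod_{i=0}^{\infty}(1-aq^i)$. For real $x>0$, the $q$-gamma function is $\Gamma_q(x)=\frac{(q;q)_\infty}{(q^x;q)_\infty}(1-q)^{1-x}$, and the $q$-digamma function is $\psi_q(x)=(\log\Gamma_q(x))'=\Gamma_q'(x)/\Gamma_q(x)$. *)

(* Defs.v *)
From HB Require Import structures.
From mathcomp Require Import all_boot all_order all_algebra.
From mathcomp Require Import all_classical all_reals all_analysis.

Set Implicit Arguments.
Unset Strict Implicit.
Unset Printing Implicit Defensive.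

Import Order.TTheory GRing.Theory Num.Theory.
Import numFieldNormedType.Exports.

Local Open Scope classical_set_scope.
Local Open Scope ring_scope.

(* (a; q)_oo. The base field is arbitrary so that a may be real or complex;
   limn returns a default value on divergent sequences, but over these two
   fields the partial products converge whenever `|q| < 1. *)
Definition qpochhammer (K : numFieldType) (a q : K) : K :=
  limn (fun n : nat => \prod_(i < n) (1 - a * q ^+ i)).

(* Meaningful for 0 < q < 1 and 0 < x, where the denominator is nonzero. *)
Definition qgamma (R : realType) (q x : R) : R :=
  qpochhammer q q / qpochhammer (q `^ x) q * (1 - q) `^ (1 - x).

Definition qdigamma (R : realType) (q x : R) : R :=
  derive1 (fun t : R => ln (qgamma q t)) x.

(* Main.v *)
Require Import Defs.
From HB Require Import structures.
From mathcomp Require Import all_boot all_order all_algebra.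
From mathcomp Require Import all_classical all_reals all_analysis.
From mathcomp Require Import ring lra.

Set Implicit Arguments.
Unset Strict Implicit.
Unset Printing Implicit Defensive.

Import Order.TTheory GRing.Theory Num.Theory.
Import numFieldNormedType.Exports.

Local Open Scope classical_set_scope.
Local Open Scope ring_scope.

(** Everything follows from one fact: [F = ln (qgamma q _)] lies strictly above
    its tangents, [F y - F x > psi x * (y - x)] for positive [x != y], with
    [psi] continuous ([ln_qgamma_tangent], [qdigamma_series_continuous]).

    The fact forces [psi] to be the derivative of [F]: exchanging [x] and [y]
    traps the difference quotient between [psi x] and [psi y]
    ([is_derive_tangent]). Hence [psi] is the q-digamma function, and at any zero
    of [psi] the tangent is horizontal, so that this zero is the strict minimum
    of [F] over the positive reals. This gives (b), and also uniqueness in (a),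
    since each of two distinct zeros would have a smaller value than the other.
    Existence is the theorem of Rolle on [[1, 2]], because qgamma takes the value
    1 at 1 and at 2.

    For the fact itself, put [u = q `^ x] and [h u = - ln (u; q)_oo], so that [F]
    is [h (q `^ x)] plus an affine function of [x]. The series [h] lies above its
    tangents in the variable [u], termwise by [ln t <= t - 1]
    ([nlog_qpoch_tangent]); the slope of these tangents is positive, and
    [x |-> q `^ x] is an exponential, which lies strictly above its own tangents.
    Composing the two inequalities gives the strict one for [F]. *)

(** * Derivatives from supporting lines *)

(** The right-hand inequality is the left-hand one with [x] and [y] exchanged, so
    this is differentiability of a function with a continuous choice of
    supporting slopes: the difference quotient is within [`|psi y - psi x|] of
    [psi x]. *)
Lemma is_derive_tangent (R : realType) (F psi : R -> R) (x : R) :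
  {for x, continuous psi} ->
  (\forall y \near x, psi x * (y - x) <= F y - F x <= psi y * (y - x)) ->
  is_derive x 1 F (psi x).
Proof.
move=> cpsi tgt; suff quot : h^-1 *: (F (h *: 1 + x) - F x) @[h --> 0^'] --> psi x.
  by apply: DeriveDef; [apply/cvg_ex; exists (psi x) | apply/cvg_lim].
apply/cvgrPdistC_le => e e0; near=> h.
have h0 : h != 0 by near: h; exact: nbhs_dnbhs_neq.
have [] : psi x * h <= F (h + x) - F x <= psi (h + x) * h /\
          `|psi (h + x) - psi x| <= e.
  near: h; apply: nbhs_dnbhs.
  have P : \forall y \near x, psi x * (y - x) <= F y - F x <= psi y * (y - x) /\
      `|psi y - psi x| <= e.
    by near=> y; split; near: y => //; apply: cvgr_distC_le.
  move/nbhs0P : P; apply: filterS => h; rewrite (addrC x h) addrK.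
  by [].
move=> /andP[lo hi]; apply: le_trans.
rewrite /GRing.scale/= mulr1 -{1}[psi x](mulKf h0) -mulrBr normrM normfV.
rewrite ler_pdivrMl ?normr_gt0// -normrM mulrBr ![h * _]mulrC.
by rewrite !ger0_norm ?subr_ge0 ?lerD2r// (le_trans lo).
Unshelve. all: by end_near. Qed.

(** * The logarithm of the q-Pochhammer symbol *)

Definition nlog_qpoch (R : realType) (q u : R) : R :=
  limn (series (fun i => - ln (1 - u * q ^+ i))).

(** The termwise derivative of [nlog_qpoch q]; multiplied by [u], it is the
    Lambert series [\sum_(n >= 1) u^n / (1 - q^n)]. *)
Definition dnlog_qpoch (R : realType) (q u : R) : R :=
  limn (series (fun i => q ^+ i / (1 - u * q ^+ i))).

(** A lower bound for the factors that is uniform in [i] and in [u <= r]; it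
    keeps every denominator below away from 0. *)
Lemma qpoch_factor_ge (R : realType) (q r u : R) (i : nat) :
  0 < q < 1 -> r < 1 -> 0 < u <= r -> 0 < 1 - r <= 1 - u * q ^+ i.
Proof.
move=> /andP[q0 q1] r1 /andP[u0 ur]; rewrite subr_gt0 r1/= lerD2l lerN2.
by apply: le_trans ur; rewrite ler_piMr ?(ltW u0)// exprn_ile1 ?ltW.
Qed.

Lemma le_ln_sub1 (R : realType) (x : R) : 0 < x -> ln x <= x - 1.
Proof.
by move=> x0; rewrite -{1}(subrK 1 x) addrC le_ln1Dx// ltrBrDl subrr.
Qed.

Lemma is_cvg_series_le_geometric (R : realType) (q C : R) (a : R ^nat) :
  0 < q < 1 -> (forall i, 0 <= a i <= C * q ^+ i) -> cvgn (series a).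
Proof.
move=> /andP[q0 q1] aC; apply: (@series_le_cvg _ _ (geometric C q)).
- by move=> i; have /andP[] := aC i.
- by move=> i; have /andP[] := aC i; exact: le_trans.
- by move=> i; have /andP[] := aC i.
- by apply: is_cvg_geometric_series; rewrite ger0_norm// ltW.
Qed.

(** With [a = u q^i], this is [- ln (1 - a) <= (1 - a)^-1 - 1 = a / (1 - a)]. *)
Lemma nlog_term_bound (R : realType) (q u : R) (i : nat) :
  0 < q < 1 -> 0 < u < 1 ->
  0 <= - ln (1 - u * q ^+ i) <= (1 - u)^-1 * q ^+ i.
Proof.
move=> q01 /andP[u0 u1].
have /andP[u1' den] : 0 < 1 - u <= 1 - u * q ^+ i.
  by apply: qpoch_factor_ge => //; rewrite u0/=.
have den0 := lt_le_trans u1' den.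
have qi0 : 0 < q ^+ i by rewrite exprn_gt0//; case/andP: q01.
rewrite oppr_ge0 ln_le0 ?gerBl ?mulr_ge0 ?(ltW u0) ?(ltW qi0)//=.
rewrite -lnV ?posrE// (le_trans (le_ln_sub1 _)) ?invr_gt0//.
have -> : (1 - u * q ^+ i)^-1 - 1 = u * q ^+ i / (1 - u * q ^+ i).
  by field; rewrite gt_eqF.
rewrite mulrC ler_pM ?invr_ge0 ?mulr_ge0 ?(ltW den0) ?(ltW u0) ?(ltW qi0)//.
  by rewrite lef_pV2.
by rewrite ler_piMl// ltW.
Qed.

Lemma is_cvg_nlog_qpoch (R : realType) (q u : R) :
  0 < q < 1 -> 0 < u < 1 -> cvgn (series (fun i => - ln (1 - u * q ^+ i))).
Proof.
move=> q01 u01.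
exact: is_cvg_series_le_geometric q01 (fun i => nlog_term_bound i q01 u01).
Qed.

Lemma dnlog_term_bound (R : realType) (q u : R) (i : nat) :
  0 < q < 1 -> 0 < u < 1 ->
  0 <= q ^+ i / (1 - u * q ^+ i) <= (1 - u)^-1 * q ^+ i.
Proof.
move=> q01 /andP[u0 u1].
have /andP[u1' den] : 0 < 1 - u <= 1 - u * q ^+ i.
  by apply: qpoch_factor_ge => //; rewrite u0/=.
have den0 := lt_le_trans u1' den.
have qi0 : 0 < q ^+ i by rewrite exprn_gt0//; case/andP: q01.
rewrite divr_ge0 ?(ltW qi0) ?(ltW den0)//= mulrC ler_wpM2r ?(ltW qi0)//.
by rewrite lef_pV2.
Qed.

Lemma is_cvg_dnlog_qpoch (R : realType) (q u : R) :
  0 < q < 1 -> 0 < u < 1 ->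
  cvgn (series (fun i => q ^+ i / (1 - u * q ^+ i))).
Proof.
move=> q01 u01.
exact: is_cvg_series_le_geometric q01 (fun i => dnlog_term_bound i q01 u01).
Qed.

(** Taking logarithms of the partial products turns the infinite product into a
    convergent series; in particular the product is not 0. *)
Lemma qpochhammerE (R : realType) (q u : R) :
  0 < q < 1 -> 0 < u < 1 -> qpochhammer u q = expR (- nlog_qpoch q u).
Proof.
move=> q01 u01; have /andP[u0 u1] := u01; apply/cvg_lim => //.
have -> : (fun n => \prod_(i < n) (1 - u * q ^+ i)) =
          (fun n => expR (- series (fun i => - ln (1 - u * q ^+ i)) n)).
  apply/funext => n; rewrite /series/= sumrN opprK expR_sum big_mkord.
  apply: eq_bigr => i _; rewrite lnK// posrE.
  have /andP[u1' den] : 0 < 1 - u <= 1 - u * q ^+ i.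
    by apply: qpoch_factor_ge => //; rewrite u0/=.
  exact: lt_le_trans den.
apply: continuous_cvg; first exact: continuous_expR.
by apply: cvgN; exact: is_cvg_nlog_qpoch.
Qed.

(** The functional equation [(u; q)_oo = (1 - u) (u q; q)_oo], used at [u = q] to
    evaluate qgamma at 2. *)
Lemma nlog_qpoch_shift (R : realType) (q u : R) :
  0 < q < 1 -> 0 < u < 1 ->
  nlog_qpoch q u = - ln (1 - u) + nlog_qpoch q (u * q).
Proof.
move=> q01 u01; apply/cvg_lim => //; rewrite -cvg_shiftS.
have -> : [sequence series (fun i => - ln (1 - u * q ^+ i)) n.+1]_n =
    (fun n => - ln (1 - u) + series (fun i => - ln (1 - (u * q) * q ^+ i)) n).
  apply/funext => n; rewrite /series/= big_nat_recl// expr0 mulr1.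
  by congr (_ + _); apply: eq_bigr => i _; rewrite exprS mulrA.
apply: cvgD; first exact: cvg_cst.
apply: is_cvg_nlog_qpoch => //.
have /andP[q0 q1] := q01; have /andP[u0 u1] := u01.
by rewrite mulr_gt0//= mulr_ilt1// ltW.
Qed.

(** Termwise, with [a = u q^i] and [b = v q^i], this is
    [ln ((1 - a) / (1 - b)) <= (1 - a) / (1 - b) - 1 = - (a - b) / (1 - b)]. *)
Lemma nlog_qpoch_tangent (R : realType) (q u v : R) :
  0 < q < 1 -> 0 < u < 1 -> 0 < v < 1 ->
  dnlog_qpoch q v * (u - v) <= nlog_qpoch q u - nlog_qpoch q v.
Proof.
move=> q01 u01 v01.
have cd := is_cvg_dnlog_qpoch q01 v01.
have cu := is_cvg_nlog_qpoch q01 u01; have cv := is_cvg_nlog_qpoch q01 v01.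
have -> : dnlog_qpoch q v * (u - v) = (u - v) *: (dnlog_qpoch q v : R^o).
  exact: mulrC.
rewrite /nlog_qpoch -lim_seriesB// /dnlog_qpoch -lim_seriesZ//.
apply: lim_series_le => [||i].
- exact: is_cvg_seriesZ.
- exact: is_cvg_seriesB.
have /andP[u0 u1] := u01; have /andP[v0 v1] := v01.
have /andP[u1' denu] : 0 < 1 - u <= 1 - u * q ^+ i.
  by apply: qpoch_factor_ge => //; rewrite u0/=.
have /andP[v1' denv] : 0 < 1 - v <= 1 - v * q ^+ i.
  by apply: qpoch_factor_ge => //; rewrite v0/=.
have denu0 := lt_le_trans u1' denu; have denv0 := lt_le_trans v1' denv.
rewrite /GRing.scale/= [leRHS](_ : _ = - (ln (1 - u * q ^+ i) - ln (1 - v * q ^+ i))); last first.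
  by rewrite opprB [RHS]addrC opprK.
rewrite -ln_div ?posrE// lerNr (le_trans (le_ln_sub1 _)) ?divr_gt0//.
rewrite le_eqVlt; apply/orP; left; apply/eqP; rewrite /GRing.scale/=.
by field; rewrite gt_eqF.
Qed.

Lemma dnlog_qpoch_gt0 (R : realType) (q u : R) :
  0 < q < 1 -> 0 < u < 1 -> 0 < dnlog_qpoch q u.
Proof.
move=> q01 u01.
have nd : nondecreasing_seq (series (fun i => q ^+ i / (1 - u * q ^+ i))).
  by apply: nondecreasing_series => i _ _; case/andP: (dnlog_term_bound i q01 u01).
apply: lt_le_trans (nondecreasing_cvgn_le nd (is_cvg_dnlog_qpoch q01 u01) 1%N).
by rewrite /series/= big_nat1 expr0 mulr1 divr_gt0// subr_gt0; case/andP: u01.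
Qed.

(** The terms at [u] and [v] differ by
    [(u - v) q^(2i) / ((1 - u q^i) (1 - v q^i))]; bounding [q^(2i)] by [q^i]
    leaves a geometric series. One inequality suffices, [u] and [v] being
    interchangeable. *)
Lemma dnlog_qpoch_lipschitz (R : realType) (q r u v : R) :
  0 < q < 1 -> r < 1 -> 0 < u <= r -> 0 < v <= r ->
  dnlog_qpoch q u <= dnlog_qpoch q v + `|u - v| / ((1 - r) ^+ 2 * (1 - q)).
Proof.
move=> q01 r1 ur vr; have /andP[q0 q1] := q01.
have /andP[u0 u1] := ur; have /andP[v0 v1] := vr.
have nq : `|q| < 1 by rewrite ger0_norm// ltW.
have cu : cvgn (series (fun i => q ^+ i / (1 - u * q ^+ i))).
  by apply: is_cvg_dnlog_qpoch => //; rewrite u0 (le_lt_trans u1).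
have cv : cvgn (series (fun i => q ^+ i / (1 - v * q ^+ i))).
  by apply: is_cvg_dnlog_qpoch => //; rewrite v0 (le_lt_trans v1).
pose C := `|u - v| / (1 - r) ^+ 2.
have cg := @is_cvg_geometric_series _ C _ nq.
have <- : limn (series (geometric C q)) =
    `|u - v| / ((1 - r) ^+ 2 * (1 - q)).
  rewrite (cvg_lim _ (@cvg_geometric_series _ C _ nq))//.
  by rewrite /C -mulrA -invfM.
rewrite /dnlog_qpoch -lim_seriesD//; apply: lim_series_le => [//||i].
  exact: is_cvg_seriesD.
have /andP[r0 denu] := qpoch_factor_ge i q01 r1 ur.
have /andP[_ denv] := qpoch_factor_ge i q01 r1 vr.
have denu0 := lt_le_trans r0 denu; have denv0 := lt_le_trans r0 denv.
have qi0 : 0 < q ^+ i by rewrite exprn_gt0.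
have qi1 : q ^+ i <= 1 by rewrite exprn_ile1// ltW.
rewrite [leRHS]/(_ + geometric C q i) -lerBlDl /=.
have -> : q ^+ i / (1 - u * q ^+ i) - q ^+ i / (1 - v * q ^+ i) =
    (u - v) * q ^+ i * q ^+ i / ((1 - u * q ^+ i) * (1 - v * q ^+ i)).
  by field; rewrite !gt_eqF.
rewrite /C [_ * q ^+ i in leRHS]mulrAC.
apply: (@le_trans _ _ (`|u - v| * q ^+ i /
    ((1 - u * q ^+ i) * (1 - v * q ^+ i)))).
  rewrite ler_wpM2r ?invr_ge0 ?mulr_ge0 ?(ltW denu0) ?(ltW denv0)//.
  rewrite ler_wpM2r ?(ltW qi0)//.
  apply: le_trans (ler_norm _) _.
  by rewrite normrM (ger0_norm (ltW qi0)) ler_piMr.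
rewrite ler_wpM2l ?mulr_ge0 ?(ltW qi0)// lef_pV2 ?posrE ?mulr_gt0 ?exprn_gt0//.
by rewrite expr2 ler_pM// ltW.
Qed.

Lemma dnlog_qpoch_continuous (R : realType) (q u : R) :
  0 < q < 1 -> 0 < u < 1 -> {for u, continuous (dnlog_qpoch q)}.
Proof.
move=> q01 /andP[u0 u1]; have /andP[q0 q1] := q01.
(* Any bound strictly between u and 1 would do. *)
pose r := (u + 1) / 2.
have ur : u < r by rewrite /r; lra.
have r1 : r < 1 by rewrite /r; lra.
have K0 : 0 < (1 - r) ^+ 2 * (1 - q).
  by rewrite mulr_gt0 ?exprn_gt0// subr_gt0.
apply/cvgrPdist_le => e e0; near=> v.
have v0 : 0 < v by near: v; exact: lt_nbhsr.
have vr : v <= r by apply/ltW; near: v; exact: lt_nbhsl.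
have uv : `|u - v| / ((1 - r) ^+ 2 * (1 - q)) <= e.
  rewrite ler_pdivrMr//; near: v.
  apply: (@cvgr_dist_le _ _ _ _ _ id); first exact: cvg_id.
  by rewrite mulr_gt0.
have ur' : 0 < u <= r by rewrite u0 ltW.
have vr' : 0 < v <= r by rewrite v0.
rewrite ler_distl; apply/andP; split.
  rewrite lerBlDr (le_trans (dnlog_qpoch_lipschitz q01 r1 vr' ur'))//.
  by rewrite lerD2l distrC.
by rewrite (le_trans (dnlog_qpoch_lipschitz q01 r1 ur' vr'))// lerD2l.
Unshelve. all: by end_near. Qed.

(** * Strict convexity of the logarithm of the q-gamma function *)

(** The derivative in [x] of
    [nlog_qpoch q (q `^ x) + (1 - x) * ln (1 - q)], by the chain rule; that this
    is [qdigamma q x] is the content of [qdigammaE]. *)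
Definition qdigamma_series (R : realType) (q x : R) : R :=
  dnlog_qpoch q (q `^ x) * (q `^ x * ln q) - ln (1 - q).

Lemma powR_gt0_lt1 (R : realType) (q x : R) :
  0 < q < 1 -> 0 < x -> 0 < q `^ x < 1.
Proof.
move=> /andP[q0 q1] x0; rewrite powR_gt0//= /powR gt_eqF// expR_lt1.
by rewrite pmulr_rlt0// ln_lt0// q0.
Qed.

Lemma qgammaE (R : realType) (q x : R) :
  0 < q < 1 -> 0 < x ->
  qgamma q x =
  expR (nlog_qpoch q (q `^ x) - nlog_qpoch q q + (1 - x) * ln (1 - q)).
Proof.
move=> q01 x0; have /andP[q0 q1] := q01.
rewrite /qgamma !qpochhammerE ?powR_gt0_lt1//.
rewrite [(1 - q) `^ _]/powR gt_eqF ?subr_gt0// expRD; congr (_ * _).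
by rewrite -expRN -expRD opprK addrC.
Qed.

Lemma ln_qgamma1 (R : realType) (q : R) : 0 < q < 1 -> ln (qgamma q 1) = 0.
Proof.
move=> q01; have /andP[q0 q1] := q01.
by rewrite qgammaE// expRK powRr1 ?ltW// !subrr mul0r addr0.
Qed.

Lemma ln_qgamma2 (R : realType) (q : R) : 0 < q < 1 -> ln (qgamma q 2) = 0.
Proof.
move=> q01; have /andP[q0 q1] := q01.
rewrite qgammaE// expRK (@powR_mulrn _ _ 2) ?ltW// (@nlog_qpoch_shift _ q q)//.
by rewrite -[q * q]/(q ^+ 2); ring.
Qed.

(** Strictness comes from the exponential:
    [q `^ y - q `^ x = q `^ x * (expR ((y - x) * ln q) - 1)] exceeds
    [q `^ x * (y - x) * ln q] when [y != x], and the positive slope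
    [dnlog_qpoch q (q `^ x)] preserves the strict inequality. *)
Lemma ln_qgamma_tangent (R : realType) (q x y : R) :
  0 < q < 1 -> 0 < x -> 0 < y -> x != y ->
  qdigamma_series q x * (y - x) < ln (qgamma q y) - ln (qgamma q x).
Proof.
move=> q01 x0 y0 xy; have /andP[q0 q1] := q01.
rewrite !qgammaE// !expRK /qdigamma_series.
have qx := powR_gt0_lt1 q01 x0; have qy := powR_gt0_lt1 q01 y0.
have /andP[qx0 _] := qx.
have tgt := nlog_qpoch_tangent q01 qy qx.
have expx : q `^ x * ln q * (y - x) < q `^ y - q `^ x.
  have -> : q `^ y = q `^ x * expR ((y - x) * ln q).
    by rewrite /powR gt_eqF// -expRD; congr expR; ring.
  rewrite -{3}[q `^ x]mulr1 -mulrBr -mulrA ltr_pM2l// ltrBrDl mulrC.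
  apply: expR_gt1Dx; apply: mulf_neq0; first by rewrite subr_eq0 eq_sym.
  by rewrite lt_eqF// ln_lt0.
have dexp : dnlog_qpoch q (q `^ x) * (q `^ x * ln q * (y - x)) <
    dnlog_qpoch q (q `^ x) * (q `^ y - q `^ x).
  by rewrite ltr_pM2l// dnlog_qpoch_gt0.
lra.
Qed.

Lemma qdigamma_series_continuous (R : realType) (q x : R) :
  0 < q < 1 -> 0 < x -> {for x, continuous (qdigamma_series q)}.
Proof.
move=> q01 x0; have /andP[q0 q1] := q01.
have cp : {for x, continuous (powR q)}.
  rewrite (_ : powR q = fun y => expR (y * ln q)); last first.
    by apply/funext => y; rewrite /powR gt_eqF.
  apply: continuous_comp; last exact: continuous_expR.
  exact: mulrr_continuous.
apply: cvgB; last exact: cvg_cst.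
apply: cvgM; last by apply: cvgM => //; exact: cvg_cst.
apply: continuous_comp => //.
by apply: dnlog_qpoch_continuous => //; exact: powR_gt0_lt1.
Qed.

Lemma is_derive_ln_qgamma (R : realType) (q x : R) :
  0 < q < 1 -> 0 < x ->
  is_derive x 1 (fun t => ln (qgamma q t)) (qdigamma_series q x).
Proof.
move=> q01 x0; apply: is_derive_tangent; first exact: qdigamma_series_continuous.
near=> y; have y0 : 0 < y by near: y; exact: lt_nbhsr.
have [->|xy] := eqVneq x y; first by rewrite !subrr !mulr0 lexx.
rewrite ltW ?ln_qgamma_tangent//=.
have := ln_qgamma_tangent q01 y0 x0; rewrite eq_sym => /(_ xy); lra.
Unshelve. all: by end_near. Qed.

Lemma qdigammaE (R : realType) (q x : R) :
  0 < q < 1 -> 0 < x -> qdigamma q x = qdigamma_series q x.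
Proof.
by move=> q01 x0; rewrite /qdigamma derive1E; case: (is_derive_ln_qgamma q01 x0).
Qed.

(** * The minimum of the q-gamma function *)

Theorem theorem1 (R : realType) (q : R) (hq0 : 0 < q) (hq1 : q < 1) :
  (exists! x0 : R, 1 < x0 < 2 /\ qdigamma q x0 = 0) /\
  (forall x0 : R, 1 < x0 < 2 -> qdigamma q x0 = 0 ->
     forall x : R, 0 < x -> qgamma q x >= qgamma q x0).
Proof.
have q01 : 0 < q < 1 by rewrite hq0.
(* The tangent at a zero of the derivative is horizontal. *)
have crit (x y : R) : 0 < x -> 0 < y -> qdigamma q x = 0 -> x != y ->
    ln (qgamma q x) < ln (qgamma q y).
  move=> x0 y0 dx xy; rewrite -subr_gt0; have := ln_qgamma_tangent q01 x0 y0 xy.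
  by rewrite -qdigammaE// dx mul0r.
split; last first.
  move=> x /andP[x1 _] dx y y0; have x0 := lt_trans ltr01 x1.
  have [->//|xy] := eqVneq x y.
  have := crit _ _ x0 y0 dx xy.
  by rewrite ltr_ln ?posrE ?qgammaE ?expR_gt0//; exact: ltW.
have [c c12 dc] : exists2 c : R, c \in `]1, 2[ &
    is_derive c (1 : R) (fun t => ln (qgamma q t)) 0.
  apply: Rolle.
  - by rewrite ltr1n.
  - move=> x; rewrite in_itv/= => /andP[x1 _].
    by case: (is_derive_ln_qgamma q01 (lt_trans ltr01 x1)).
  - apply: derivable_within_continuous => x; rewrite in_itv/= => /andP[x1 _].
    by case: (is_derive_ln_qgamma q01 (lt_le_trans ltr01 x1)).
  - by rewrite ln_qgamma1// ln_qgamma2.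
exists c; split.
  by split; [move: c12; rewrite in_itv | rewrite /qdigamma derive1E; case: dc].
move=> y [/andP[y1 _] dy]; have /andP[c1 _] : 1 < c < 2 by move: c12; rewrite in_itv.
have dc0 : qdigamma q c = 0 by rewrite /qdigamma derive1E; case: dc.
have [//|cy] := eqVneq c y.
have y0 := lt_trans ltr01 y1; have c0 := lt_trans ltr01 c1.
have := lt_trans (crit _ _ c0 y0 dc0 cy).
by move=> /(_ _ (crit _ _ y0 c0 dy _)); rewrite ltxx eq_sym => /(_ cy).
Qed.
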